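(* Let $M$ be a u.p.-monoid and let $R$ be a central reduced ring. Then $R$ is an $M$-central Armendariz ring.
   Context: All rings are associative with identity. $C(R)$ denotes the center of a ring $R$, and $R[M]$ denotes the monoid ring of a monoid $M$ over $R$. A ring $R$ is called $M$-central Armendariz if whenever $\alpha=a_1g_1+\dots+a_mg_m\in R[M]$ and $\beta=b_1h_1+\dots+b_nh_n\in R[M]$ (with $a_i,b_j\in R$, $g_1,\dots,g_m\in M$ pairwise distinct, and $h_1,\dots,h_n\in M$ pairwise distinct) satisfy $\alpha\beta=0$, then $a_ib_j\in C(R)$ for all $1\le i\le m$ and $1\le j\le n$. A ring $R$ is called central reduced if every nilpotent element of $R$ is central. A monoid $M$ is called a u.p.-monoid (unique product monoid) if for any two nonempty finite subsets $A,B\subseteq M$ there exists an element $g\in M$ uniquely presented in the form $ab$ with $a\in A$ and $b\in B$. *)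

(* Defs.v *)
From HB Require Import structures.
From mathcomp Require Import all_boot all_order all_algebra.
From mathcomp Require Import finmap.
From mathcomp Require Import multinomials.monalg.

Set Implicit Arguments.
Unset Strict Implicit.
Unset Printing Implicit Defensive.

Import GRing.Theory.
Local Open Scope fset_scope.
Local Open Scope ring_scope.

(* The library puts a ring structure on {malg R[M]} only when M is a monomType, *)
(* which forces x * y = 1 -> x = y = 1 and so excludes nontrivial groups, and   *)
(* when R is nontrivial. Here the convolution ring structure is put on an alias *)
(* of {malg R[M]}, for an arbitrary monoid M and an arbitrary ring R.           *)
Definition monoid_ring (M : monoidType) (R : pzRingType) : Type := {malg R[M]}.

HB.instance Definition _ (M : monoidType) (R : pzRingType) :=
  GRing.Zmodule.on (monoid_ring M R).

Definition mterm (M : monoidType) (R : pzRingType) (a : R) (g : M) :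
  monoid_ring M R := << a *g g >>.

Section MonoidRing.
Variables (M : monoidType) (R : pzRingType).
Implicit Types (x y z : monoid_ring M R) (a b : R) (g h : M).

Definition mring_one : monoid_ring M R := mterm 1 1%g.

Definition mring_mul x y : monoid_ring M R :=
  \sum_(g <- msupp x) \sum_(h <- msupp y) mterm (x@_g * y@_h) (g * h)%g.

Lemma mterm0 g : mterm (0 : R) g = 0.
Proof. exact: monalgU0. Qed.

Lemma mtermD g a b : mterm (a + b) g = mterm a g + mterm b g.
Proof. exact: monalgUD. Qed.

Lemma mring_mulEw (d1 d2 : {fset M}) x y :
  msupp x `<=` d1 -> msupp y `<=` d2 ->
  mring_mul x y = \sum_(g <- d1) \sum_(h <- d2) mterm (x@_g * y@_h) (g * h)%g.
Proof.
move=> le_d1 le_d2; rewrite /mring_mul (big_fset_incl _ le_d1) /=.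
  apply/eq_bigr=> g _; apply/big_fset_incl => // h _ /mcoeff_outdom ->.
  by rewrite mulr0 mterm0.
move=> g _ /mcoeff_outdom xg.
by rewrite big1 => // h _; rewrite xg mul0r mterm0.
Qed.

Lemma mring_mul0r : left_zero 0 mring_mul.
Proof. by move=> x; rewrite /mring_mul msupp0 big_seq_fset0. Qed.

Lemma mring_mulr0 : right_zero 0 mring_mul.
Proof.
by move=> x; rewrite /mring_mul big1 // => g _; rewrite msupp0 big_seq_fset0.
Qed.

Lemma mring_mulDl : left_distributive mring_mul +%R.
Proof.
move=> x1 x2 y; rewrite (mring_mulEw (msuppD_le _ _) (fsubset_refl _)).
rewrite (mring_mulEw (fsubsetUl _ (msupp x2)) (fsubset_refl (msupp y))).
rewrite (mring_mulEw (fsubsetUr (msupp x1) _) (fsubset_refl (msupp y))).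
rewrite -big_split /=; apply/eq_bigr=> g _.
rewrite -big_split /=; apply/eq_bigr=> h _.
by rewrite mcoeffD mulrDl mtermD.
Qed.

Lemma mring_mulDr : right_distributive mring_mul +%R.
Proof.
move=> x y1 y2; rewrite (mring_mulEw (fsubset_refl _) (msuppD_le _ _)).
rewrite (mring_mulEw (fsubset_refl (msupp x)) (fsubsetUl _ (msupp y2))).
rewrite (mring_mulEw (fsubset_refl (msupp x)) (fsubsetUr (msupp y1) _)).
rewrite -big_split /=; apply/eq_bigr=> g _.
rewrite -big_split /=; apply/eq_bigr=> h _.
by rewrite mcoeffD mulrDr mtermD.
Qed.

Lemma mring_mul_term a b g h :
  mring_mul (mterm a g) (mterm b h) = mterm (a * b) (g * h)%g.
Proof. by rewrite (mring_mulEw msuppU_le msuppU_le) !big_seq_fset1 !mcoeffUU. Qed.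

Lemma mring_sumE x : x = \sum_(g <- msupp x) mterm x@_g g.
Proof. exact: monalgE. Qed.

Lemma mring_mul_suml (I : Type) (s : seq I) (F : I -> monoid_ring M R) y :
  mring_mul (\sum_(i <- s) F i) y = \sum_(i <- s) mring_mul (F i) y.
Proof.
exact: (big_morph (mring_mul^~ y) (fun u v => mring_mulDl u v y) (mring_mul0r y)).
Qed.

Lemma mring_mul_sumr (I : Type) (s : seq I) (F : I -> monoid_ring M R) x :
  mring_mul x (\sum_(i <- s) F i) = \sum_(i <- s) mring_mul x (F i).
Proof. exact: (big_morph (mring_mul x) (mring_mulDr x) (mring_mulr0 x)). Qed.

Lemma mring_mul1r : left_id mring_one mring_mul.
Proof.
move=> x; rewrite [in LHS](mring_sumE x) mring_mul_sumr [RHS]mring_sumE.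
by apply/eq_bigr=> g _; rewrite mring_mul_term mul1r mul1g.
Qed.

Lemma mring_mulr1 : right_id mring_one mring_mul.
Proof.
move=> x; rewrite [in LHS](mring_sumE x) mring_mul_suml [RHS]mring_sumE.
by apply/eq_bigr=> g _; rewrite mring_mul_term mulr1 mulg1.
Qed.

Lemma mring_mulA : associative mring_mul.
Proof.
move=> x y z; rewrite (mring_sumE x) !mring_mul_suml; apply/eq_bigr=> g _.
rewrite (mring_sumE y) mring_mul_suml !mring_mul_sumr mring_mul_suml.
apply/eq_bigr=> h _.
rewrite (mring_sumE z) !mring_mul_sumr; apply/eq_bigr=> k _.
by rewrite !mring_mul_term mulrA mulgA.
Qed.

End MonoidRing.

HB.instance Definition _ (M : monoidType) (R : pzRingType) :=
  GRing.Zmodule_isPzRing.Build (monoid_ring M R)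
    (@mring_mulA M R) (@mring_mul1r M R) (@mring_mulr1 M R)
    (@mring_mulDl M R) (@mring_mulDr M R).

Lemma mtermM (M : monoidType) (R : pzRingType) (a b : R) (g h : M) :
  mterm a g * mterm b h = mterm (a * b) (g * h)%g.
Proof. exact: mring_mul_term. Qed.

Definition central (R : pzRingType) (c : R) : Prop :=
  forall r : R, GRing.comm c r.

Definition nilpotent_elt (R : pzRingType) (x : R) : Prop :=
  exists n : nat, x ^+ n = 0.

Definition central_reduced (R : pzRingType) : Prop :=
  forall x : R, nilpotent_elt x -> central x.

Definition up_monoid (M : monoidType) : Prop :=
  forall A B : {fset M}, A != fset0 -> B != fset0 ->
  exists g : M, exists! p : M * M,
    [/\ p.1 \in A, p.2 \in B & (p.1 * p.2)%g = g].

(* The coefficients a i and b j may vanish. *)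
Definition central_Armendariz (M : monoidType) (R : pzRingType) : Prop :=
  forall (m n : nat) (a : 'I_m -> R) (g : 'I_m -> M)
         (b : 'I_n -> R) (h : 'I_n -> M),
  injective g -> injective h ->
  (\sum_(i < m) mterm (a i) (g i)) * (\sum_(j < n) mterm (b j) (h j)) = 0 ->
  forall (i : 'I_m) (j : 'I_n), central (a i * b j).

(* Main.v *)
Require Import Defs.
From mathcomp Require Import all_boot all_order all_algebra.
From mathcomp Require Import finmap.
From mathcomp Require Import multinomials.monalg.

(** Nilpotent elements of a central reduced ring [R] commute with everything, so
    they form a two-sided ideal [N], and [R / N] is reduced.  Over a unique
    product monoid a reduced ring is Armendariz, so [a_i b_j] vanishes in
    [R / N]; that is, [a_i b_j] is nilpotent, hence central.

    The Armendariz property is proved modulo any ideal [N] with reduced quotient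
    ([up_conv_mem]), by induction on the total size of the two supports.  Let
    [g0 h0] be a uniquely presented product.  The coefficient of the product
    [x y] at [g0 h0] is the single term [a0 b0], so [a0 b0] is in [N]; reducedness
    allows one to swap factors, so [b0 a0] is in [N] too.  Consequently [y a0] has,
    modulo [N], no term at [h0], and the induction hypothesis applied to [x] and
    [y a0] gives [a0 b a0] in [N], hence [a0 b] in [N], for every coefficient
    [b] of [y].  The term of [x] at [g0] thus contributes nothing to [x y]
    modulo [N]; it can be deleted, and the induction hypothesis applied again.

    Everything is phrased with membership in [N] instead of equality in the
    quotient [R / N], because nilpotency need not be decidable. *)

Set Implicit Arguments.
Unset Strict Implicit.
Unset Printing Implicit Defensive.

Import GRing.Theory.
Local Open Scope fset_scope.
Local Open Scope ring_scope.

(** * Ideals with reduced quotient *)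

(** The last field says that the quotient by [N] has no nonzero element of
    square zero, which is equivalent to its being reduced. *)
Record reduced_ideal (R : pzRingType) (N : R -> Prop) : Prop := ReducedIdeal {
  rideal0 : N 0;
  ridealD : forall x y, N x -> N y -> N (x + y);
  ridealMl : forall r x, N x -> N (r * x);
  ridealMr : forall r x, N x -> N (x * r);
  rideal_sqr : forall x, N (x * x) -> N x }.

Section ReducedIdeal.
Variables (R : pzRingType) (N : R -> Prop) (idN : reduced_ideal N).

Lemma ridealB x y : N x -> N y -> N (x - y).
Proof. move=> Nx Ny; rewrite -mulN1r; apply: (ridealD idN) => //.
exact: (ridealMl idN). Qed.

Lemma ridealMb x (c : bool) : N x -> N (x *+ c).
Proof. by case: c => // _; apply: (rideal0 idN). Qed.

Lemma rideal_sum (I : eqType) (s : seq I) (F : I -> R) :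
  (forall i, i \in s -> N (F i)) -> N (\sum_(i <- s) F i).
Proof.
move=> NF; rewrite big_seq; elim/big_ind: _ => //; first exact: (rideal0 idN).
exact: (ridealD idN).
Qed.

(** [(y x)^2 = y (x y) x]. *)
Lemma ridealC x y : N (x * y) -> N (y * x).
Proof.
move=> Nxy; apply: (rideal_sqr idN).
by rewrite mulrA -(mulrA y); apply/(ridealMr idN)/(ridealMl idN).
Qed.

End ReducedIdeal.

(** * The nilpotent elements of a central reduced ring *)

Lemma nilpotentM (R : pzRingType) (r x : R) :
  GRing.comm r x -> nilpotent_elt x -> nilpotent_elt (r * x).
Proof. by move=> crx [n xn0]; exists n; rewrite exprMn_comm // xn0 mulr0. Qed.

(** In the binomial expansion of [(x + y)^(n + m)] every term contains [x^n] or
    [y^m]. *)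
Lemma nilpotentD (R : pzRingType) (x y : R) :
  GRing.comm x y -> nilpotent_elt x -> nilpotent_elt y -> nilpotent_elt (x + y).
Proof.
move=> cxy [n xn0] [m ym0]; exists (n + m)%N.
rewrite exprDn_comm // big1 // => i _.
have [le_mi|lt_im] := leqP m i.
  by rewrite -(subnK le_mi) [y ^+ _]exprD ym0 !mulr0 mul0rn.
by rewrite -addnBA 1?ltnW // exprD xn0 !mul0r mul0rn.
Qed.

Lemma central_reduced_nil_ideal (R : pzRingType) :
  central_reduced R -> reduced_ideal (@nilpotent_elt R).
Proof.
move=> hR; split.
- by exists 1%N; rewrite expr1.
- by move=> x y Nx Ny; apply: nilpotentD => //; apply: hR.
- by move=> r x Nx; apply: nilpotentM => //; apply/commr_sym/hR.
- by move=> r x Nx; rewrite hR //; apply: nilpotentM => //; apply/commr_sym/hR.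
- by move=> x [n xn0]; exists (2 * n)%N; rewrite exprM expr2.
Qed.

(** * Convolution over a unique product monoid *)

Section Convolution.
Variables (M : monoidType) (R : pzRingType).
Implicit Types (A B : {fset M}) (a b : M -> R) (g h k : M).

(** The coefficient at [k] of the product of the elements of the monoid ring with
    coefficients [a] on [A] and [b] on [B]. *)
Definition conv A B a b k : R :=
  \sum_(g <- A) \sum_(h <- B) (a g * b h) *+ ((g * h)%g == k).

Lemma conv_delL g0 A B a b k : g0 \in A ->
  conv A B a b k = \sum_(h <- B) (a g0 * b h) *+ ((g0 * h)%g == k)
                   + conv (A `\ g0) B a b k.
Proof. by move=> Ag0; rewrite /conv (big_fsetD1 g0). Qed.

Lemma conv_delR h0 A B a b k : h0 \in B ->
  conv A B a b k = \sum_(g <- A) (a g * b h0) *+ ((g * h0)%g == k)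
                   + conv A (B `\ h0) a b k.
Proof.
move=> Bh0; rewrite /conv -big_split; apply: eq_bigr => g _.
by rewrite (big_fsetD1 h0).
Qed.

Lemma conv_mulr A B a b r k :
  conv A B a (fun h => b h * r) k = conv A B a b k * r.
Proof.
rewrite /conv mulr_suml; apply: eq_bigr => g _.
by rewrite mulr_suml; apply: eq_bigr => h _; rewrite mulrA mulrnAl.
Qed.

Lemma conv_unique A B a b g0 h0 : g0 \in A -> h0 \in B ->
  (forall g h, g \in A -> h \in B -> (g * h = g0 * h0)%g -> (g0, h0) = (g, h)) ->
  conv A B a b (g0 * h0)%g = a g0 * b h0.
Proof.
move=> Ag0 Bh0 uniq_gh; rewrite (conv_delL _ _ _ _ Ag0) (big_fsetD1 h0) //= eqxx.
rewrite mulr1n [X in _ + X + _]big_seq big1 => [|h]; last first.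
  rewrite !inE => /andP[/eqP ne_h Bh]; case: eqP => // eq_gh.
  by case: (uniq_gh _ _ Ag0 Bh eq_gh) => eq_h; case: ne_h.
rewrite /conv [X in _ + X]big_seq big1 ?addr0 // => g.
rewrite !inE => /andP[/eqP ne_g Ag]; rewrite big_seq big1 // => h Bh.
case: eqP => // eq_gh.
by case: (uniq_gh _ _ Ag Bh eq_gh) => eq_g; case: ne_g.
Qed.

Lemma mcoeff_mulE (x y : monoid_ring M R) k :
  (x * y : monoid_ring M R)@_k = conv (msupp x) (msupp y) (mcoeff^~ x) (mcoeff^~ y) k.
Proof.
rewrite raddf_sum; apply: eq_bigr => g _.
by rewrite raddf_sum; apply: eq_bigr => h _; exact: mcoeffU.
Qed.

Lemma mcoeff_sum_term n (a : 'I_n -> R) (g : 'I_n -> M) i : injective g ->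
  (\sum_(j < n) mterm (a j) (g j) : monoid_ring M R)@_(g i) = a i.
Proof.
move=> inj_g; rewrite raddf_sum (bigD1 i) //= mcoeffUU big1 ?addr0 // => j ne_ji.
by rewrite mcoeffU (inj_eq inj_g) (negPf ne_ji).
Qed.

(** The Armendariz property of the reduced ring [R / N]. *)
Lemma up_conv_mem (N : R -> Prop) A B a b :
    up_monoid M -> reduced_ideal N -> (forall k, N (conv A B a b k)) ->
  forall g h, g \in A -> h \in B -> N (a g * b h).
Proof.
move=> hM idN; move: {2}(_ + _)%N (leqnn (#|` A| + #|` B|)) => n.
elim: n A B b => [|n IHn] A B b le_n Nab g h Ag Bh.
  move: le_n; rewrite leqn0 addn_eq0 cardfs_eq0 => /andP[/eqP A0 _].
  by rewrite A0 inE in Ag.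
have [||_ [[g0 h0] /= [[Ag0 Bh0 <-] uniq_gh]]] := hM A B.
- by apply/fset0Pn; exists g.
- by apply/fset0Pn; exists h.
have Nab0 : N (a g0 * b h0).
  rewrite -(conv_unique a b Ag0 Bh0) // => g1 h1 Ag1 Bh1 eq_gh.
  exact: uniq_gh (g1, h1) (And3 Ag1 Bh1 eq_gh).
have Nba0 : N (b h0 * a g0) by apply: (ridealC idN).
have Na0 h1 : h1 \in B -> N (a g0 * b h1).
  move=> Bh1; have [-> //|ne_h] := eqVneq h1 h0.
  apply: (rideal_sqr idN); rewrite mulrA; apply: (ridealMr idN); rewrite -mulrA.
  (* As b h0 * a g0 is in N, the right factor b * a g0 lives on B `\ h0 modulo N. *)
  apply: (IHn A (B `\ h0) (fun h => b h * a g0)) => //; last by rewrite !inE ne_h.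
    by move: le_n; rewrite (cardfsD1 h0 B) Bh0 addnCA.
  move=> k.
  have Nk : N (conv A B a (fun h => b h * a g0) k).
    by rewrite conv_mulr; apply: (ridealMr idN).
  rewrite -[conv _ _ _ _ _](addKr (\sum_(g <- A) (a g * (b h0 * a g0)) *+ ((g * h0)%g == k))).
  rewrite -(conv_delR _ _ _ _ Bh0) addrC; apply: (ridealB idN) => //.
  by apply: (rideal_sum idN) => // g1 _; apply: (ridealMb idN) => //; apply: (ridealMl idN).
have [-> |ne_g] := eqVneq g g0; first exact: Na0.
apply: (IHn (A `\ g0) B b) => //; last by rewrite !inE ne_g.
  by move: le_n; rewrite (cardfsD1 g0 A) Ag0.
move=> k; rewrite -[conv _ _ _ _ _](addKr (\sum_(h <- B) (a g0 * b h) *+ ((g0 * h)%g == k))).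
rewrite -(conv_delL _ _ _ _ Ag0) addrC; apply: (ridealB idN) => //.
by apply: (rideal_sum idN) => // h1 Bh1; apply: (ridealMb idN) => //; apply: Na0.
Qed.

Lemma up_mcoeff_mul_mem (N : R -> Prop) (x y : monoid_ring M R) :
    up_monoid M -> reduced_ideal N -> x * y = 0 ->
  forall g h, N (x@_g * y@_h).
Proof.
move=> hM idN xy0 g h.
have [xg|/mcoeff_outdom->] := boolP (g \in msupp x); last first.
  by rewrite mul0r; apply: (rideal0 idN).
have [yh|/mcoeff_outdom->] := boolP (h \in msupp y); last first.
  by rewrite mulr0; apply: (rideal0 idN).
apply: (up_conv_mem (a := mcoeff^~ x) (b := mcoeff^~ y) hM idN _ xg yh) => k.
by rewrite -mcoeff_mulE xy0 mcoeff0; apply: (rideal0 idN).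
Qed.

End Convolution.

Theorem theorem2p3 (M : monoidType) (R : pzRingType)
    (hM : up_monoid M) (hR : central_reduced R) :
  central_Armendariz M R.
Proof.
move=> m n a g b h inj_g inj_h ab0 i j; apply: (hR).
have := up_mcoeff_mul_mem hM (central_reduced_nil_ideal hR) ab0 (g i) (h j).
by rewrite !mcoeff_sum_term.
Qed.
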